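(* Let $a,b\ge 1$ be integers. The sun $S(3;a,b,b)$ is $e$-positive if and only if $a=4$ and $b=2$.
   Context: All graphs are finite and simple. $P_k$ denotes the path with $k$ vertices; for $k=1$ the single vertex counts as its leaf. For positive integers $\lambda_1,\lambda_2,\lambda_3$, the sun graph $S(3;\lambda_1,\lambda_2,\lambda_3)$ is obtained from the triangle with vertices $v_1,v_2,v_3$ and three disjoint paths $P_{\lambda_1},P_{\lambda_2},P_{\lambda_3}$ (disjoint from the triangle) by connecting $v_i$ by an edge to a leaf of $P_{\lambda_i}$ for $i=1,2,3$. The chromatic symmetric function of a graph $G$ with vertices $v_1,\ldots,v_d$ is $X_G=\sum_{\kappa} x_{\kappa(v_1)}\cdots x_{\kappa(v_d)}$, the sum over all proper colourings $\kappa:V(G)\to\mathbb{N}$, with $x_1,x_2,\ldots$ commuting variables. $G$ is $e$-positive if all coefficients of $X_G$ in the basis $\{e_\lambda\}$ of elementary symmetric functions ($e_\lambda=e_{\lambda_1}e_{\lambda_2}\cdots$) are nonnegative. *)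

(* Defs.v *)
From HB Require Import structures.
From mathcomp Require Import all_boot all_order all_algebra.
From mathcomp Require Import finmap mpoly.

Set Implicit Arguments.
Unset Strict Implicit.
Unset Printing Implicit Defensive.

Import Order.TTheory GRing.Theory Num.Theory.
Local Open Scope ring_scope.

Record sgraph := SGraph {
  vertex : finType;
  edge : rel vertex;
  edge_sym : ssrbool.symmetric edge;
  edge_irr : irreflexive edge
}.

(* The triangle vertex v_i is [inl i]; the [p]-th vertex (from 0) of the path *)
(* attached to it is [inr (Tagged _ p)].  The leaf joined to v_i is the one   *)
(* with p = 0 (the only vertex when l i = 1).                                 *)
Definition sun_vertex (l : 'I_3 -> nat) : finType :=
  ('I_3 + {i : 'I_3 & 'I_(l i)})%type.

Definition sun_edge (l : 'I_3 -> nat) : rel (sun_vertex l) := fun x y =>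
  match x, y with
  | inl i, inl j => i != j
  | inl i, inr q => (tag q == i) && (tagged q == 0%N :> nat)
  | inr p, inl j => (tag p == j) && (tagged p == 0%N :> nat)
  | inr p, inr q => (tag p == tag q) &&
      (((tagged p).+1 == tagged q :> nat) || ((tagged q).+1 == tagged p :> nat))
  end.

Lemma sun_edge_sym (l : 'I_3 -> nat) : ssrbool.symmetric (@sun_edge l).
Proof.
move=> [i|p] [j|q] //=; first by rewrite eq_sym.
by rewrite eq_sym orbC.
Qed.

Lemma sun_edge_irr (l : 'I_3 -> nat) : irreflexive (@sun_edge l).
Proof. by move=> [i|p] /=; rewrite ?eqxx // orbb gtn_eqF. Qed.

(* S(3; l1, l2, l3) *)
Definition sun3 (l1 l2 l3 : nat) : sgraph :=
  let l := tnth [tuple l1; l2; l3] in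
  SGraph (@sun_edge_sym l) (@sun_edge_irr l).

(* A symmetric function in x_1, x_2, ... is represented, as an element of the *)
(* inverse limit (Macdonald I.2), by the family of its specializations        *)
(* f(x_1, ..., x_n, 0, 0, ...), one for each n.  The coefficient of a given   *)
(* monomial is seen as soon as n is large enough, so two symmetric functions  *)
(* are equal iff their specializations are equal for every n.                 *)
Definition symfun := forall n : nat, {mpoly int[n]}.

Definition proper_colouring (G : sgraph) (n : nat)
    (k : {ffun vertex G -> 'I_n}) : bool :=
  [forall x, forall y, edge x y ==> (k x != k y)].

(* Setting x_i = 0 for i > n leaves the proper colourings with values among   *)
(* the first n colours.                                                       *)
Definition chromatic_symfun (G : sgraph) : symfun := fun n =>
  \sum_(k : {ffun vertex G -> 'I_n} | proper_colouring k)
     \prod_(v : vertex G) 'X_(k v).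

Definition is_partition (l : seq nat) : bool := sorted geq l && (0%N \notin l).

(* [mesym n int k] is 0 when k > n, as is e_k(x_1, ..., x_n).                 *)
Definition elem_symfun (l : seq nat) : symfun := fun n =>
  \prod_(k <- l) mesym n int k.

(* [c] gives the coefficients of [f] in the basis (e_l), l a partition; the   *)
(* e_l form a Z-basis of the integral symmetric functions, so [c] is unique   *)
(* and its values are integers.                                               *)
Definition e_expansion (f : symfun) (c : {fsfun seq nat -> int with 0}) : Prop :=
  (forall l, l \in finsupp c -> is_partition l) /\
  (forall n, f n = \sum_(l <- finsupp c) c l *: elem_symfun l n).

Definition e_positive (G : sgraph) : Prop :=
  exists c : {fsfun seq nat -> int with 0},
    e_expansion (chromatic_symfun G) c /\ (forall l, 0 <= c l).

(* Main.v *)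
From HB Require Import structures.
From mathcomp Require Import all_boot all_order all_algebra all_field.
From mathcomp Require Import finmap mpoly ring zify.
Require Import Defs.

(** Write P_m for the chromatic symmetric function of the path with m vertices,
    P_0 = 1, and n = a + 2b + 3 for the number of vertices of S(3;a,b,b).

    Colour the sun by its triangle first: if A_p(c) is the generating function
    of the colourings of a path with p vertices whose last vertex has colour c,
    the sun is the sum of A_(a+1)(c) A_(b+1)(d) A_(b+1)(e) over distinct colours
    c, d, e.  From A_(p+1)(c) = x_c (P_p - A_p(c)) the sums over c of products
    of two or three A's telescope, and inclusion-exclusion gives
    (lemma [sum_proper_sun3])

      X = 2 sum_(0 <= i <= b) P_i P_(n-i) - 2 sum_(b+2 <= j <= 2b+1) P_j P_(n-j)
          - P_(2b+2) P_(a+1).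

    The same relation, multiplied by E(z) = prod_c (1 + x_c z), yields the
    recursion P_m = e_m + sum_(1 <= j <= m) (j-1) e_j P_(m-j)
    ([path_weightS]), so X is an explicit integral polynomial in the e_k.

    A negative e-coefficient is detected without comparing coefficients: over
    an algebraically closed field the x_i can be chosen so that the e_k take any
    prescribed values with finitely many nonzero ones
    ([elementary_specialisation]), and an e-positive function takes nonnegative
    values where all e_k are nonnegative ([e_positive_specialisation]).

    Let e_k = 1 for b+2 <= k <= 2b+1 and e_k = 0 for every other k >= 1.  Then
    P_i = 0 for 1 <= i <= b+1, and P_j = j for j in the chosen interval; by the
    recursion the leading terms of X cancel, leaving -2 times the sum of the
    P_(n-j), minus P_(2b+2) P_(a+1) ([sun_expr_long]).  All these numbers are
    nonnegative, and some P_(n-j) is positive exactly when n is a sum of at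
    least two integers from [b+2, 2b+1].  For b >= 2 every n >= 2b+4 is such a
    sum, with the single exception b = 2, n = 11, that is a = 4
    ([path_seq_gt0]).

    For b = 1 the interval is {3}, which is too small; the specialisation at
    {2, 3} is negative except for a = 2, 5, 8, and in these three cases the
    specialisation at {3, 4} is negative.

    For a = 4, b = 2 the formula reads
    X = 2 (P_11 + P_1 P_10 + P_2 P_9) - 2 P_4 P_7 - 3 P_5 P_6, and expanding
    both sides of this difference in the e_l shows that every coefficient of the
    first one dominates. *)

Set Implicit Arguments.
Unset Strict Implicit.
Unset Printing Implicit Defensive.

Import Order.TTheory GRing.Theory Num.Theory.
Local Open Scope ring_scope.

(** * Colourings of paths *)

Section PathWeights.
Variables (R : comNzRingType) (C : finType) (x : C -> R).

(** The weight of a colouring is the product of the values of [x] at its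
    colours; this is the total weight of the proper colourings of a path with [m]
    vertices, one of whose leaves is joined to a further vertex of colour [c]. *)
Fixpoint arm_weight (m : nat) (c : C) : R :=
  if m is m'.+1 then \sum_(d | d != c) x d * arm_weight m' d else 1.

(** The total weight of the proper colourings of a path with [m] vertices in
    which a fixed leaf has colour [c]; the value 0 at [m = 0] makes
    [end_weightS] hold from the start. *)
Definition end_weight (m : nat) (c : C) : R :=
  if m is m'.+1 then x c * arm_weight m' c else 0.

Definition path_weight (m : nat) : R :=
  if m is 0 then 1 else \sum_c end_weight m c.

Arguments path_weight : simpl never.

Lemma sum_end_weight m : \sum_c end_weight m.+1 c = path_weight m.+1.
Proof. by []. Qed.

Lemma arm_weightE m c : arm_weight m c = path_weight m - end_weight m c.
Proof.
case: m => [|m] /=; first by rewrite subr0.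
by rewrite /path_weight [in RHS](bigD1 c) //= addrAC subrr add0r.
Qed.

Lemma end_weightS m c :
  end_weight m.+1 c = x c * (path_weight m - end_weight m c).
Proof. by rewrite /= arm_weightE. Qed.

Arguments end_weight : simpl never.

(** The generating polynomial of the elementary symmetric functions. *)
Definition epoly : {poly R} := \prod_c (1 + x c *: 'X).

Lemma deriv_epoly :
  epoly^`() = \sum_c x c *: \prod_(d | d != c) (1 + x d *: 'X).
Proof.
have deriv_prod (s : seq C) : uniq s ->
    (\prod_(c <- s) (1 + x c *: 'X))^`() =
    \sum_(c <- s) x c *: \prod_(d <- s | d != c) (1 + x d *: 'X).
  elim: s => [|c s IHs] /=; first by rewrite !big_nil -polyC1 derivC.
  case/andP=> cNs /IHs {}IHs.
  rewrite !big_cons derivM IHs derivD derivZ derivX -polyC1 derivC add0r eqxx.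
  rewrite -scalerAl mul1r /=; congr (_ + _).
    congr (_ *: _); rewrite big_seq [RHS]big_seq_cond; apply: eq_bigl => d.
    by case: eqVneq cNs => [->|_]; rewrite ?andbT // => /negPf->.
  rewrite big_distrr /= !big_seq; apply: eq_bigr => d ds.
  rewrite big_cons; case: eqVneq cNs ds => [-> /negPf->//|_ _ _].
  by rewrite scalerAr.
rewrite /epoly deriv_prod ?index_enum_uniq //.
Qed.

(** The relation [end_weightS] says that A_c = sum_m A_m(c) z^m satisfies
    (1 + x_c z) A_c = x_c z W, with W = sum_m P_m z^m.  Multiply by
    E(z) / (1 + x_c z) and sum over c: E (W - 1) = z E' W.  Here the series are
    truncated after degree m + 1, which creates errors in degree m + 2 only. *)
Lemma path_weightS m : path_weight m.+1 = epoly`_m.+1 +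
  \sum_(j < m.+1) j%:R * epoly`_j.+1 * path_weight (m - j).
Proof.
pose W := \poly_(k < m.+2) path_weight k.
pose A c := \poly_(k < m.+2) end_weight k c.
pose E' c := \prod_(d | d != c) (1 + x d *: 'X).
pose r c := x c * (path_weight m.+1 - end_weight m.+1 c).
have AE c : (1 + x c *: 'X) * A c = x c *: ('X * W) - r c *: 'X^(m.+2).
  apply/polyP => k; rewrite mulrDl mul1r -scalerAl coefB coefD !coefZ.
  rewrite coefXn !coefXM !coef_poly; case: k => [|k] /=.
    by rewrite !mulr0 addr0 subr0.
  rewrite ltnS eqSS; case: (ltngtP k m.+1) => [k_lt|k_gt|->]; last first.
  - by rewrite ltnSn /r mulr1; ring.
  - by rewrite ltnNge k_gt /= !mulr0; ring.
  by rewrite ltnS (ltnW k_lt) -/(end_weight k.+1 c) end_weightS mulr0; ring.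
have WE : W - 1 = \sum_c A c.
  apply/polyP => k; rewrite coefB coef1 coef_sum coef_poly.
  under eq_bigr do rewrite coef_poly.
  case: ifP => k_lt; last by rewrite big1 //; case: k k_lt => //= *; rewrite subr0.
  case: k k_lt => [|k] _; last by rewrite subr0.
  by rewrite subrr big1.
have EE c : epoly = E' c * (1 + x c *: 'X).
  by rewrite /epoly (bigD1 c) //= mulrC.
have : epoly * (W - 1) =
    'X * epoly^`() * W - 'X^(m.+2) * \sum_c r c *: E' c.
  rewrite WE big_distrr deriv_epoly /= !mulr_sumr mulr_suml -sumrB.
  apply: eq_bigr => c _; rewrite (EE c) -(mulrA (E' c)) AE -/(E' c).
  rewrite -!mul_polyC; ring.
move/(congr1 (fun p : {poly R} => p`_m.+1)).
rewrite mulrBr mulr1 !coefB coefXnM ltnSn subr0 !coefM => /eqP.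
rewrite subr_eq => /eqP; rewrite big_ord_recl [in X in _ = X -> _]big_ord_recl.
rewrite coefXM /= mul0r add0r.
rewrite {1}/epoly coef0_prod big1 => [|c _]; last first.
  by rewrite coefD coef1 coefZ coefX mulr0 addr0.
rewrite mul1r subn0 coef_poly ltnSn => /(canRL (addrK _)) ->.
rewrite [X in X - _]addrC -addrA; congr (_ + _); rewrite -sumrB.
apply: eq_bigr => j _; rewrite coefXM coef_deriv coef_poly /=.
rewrite /bump /= add1n subSS ltnS ltnW ?ltnS ?leq_subr // -mulrBl.
by rewrite mulrSr addrK mulr_natl.
Qed.

(** Inclusion-exclusion over the coincidences among three colours. *)
Lemma sum_distinct (f g h : C -> R) :
  \sum_c \sum_(d | d != c) \sum_(e | (e != c) && (e != d)) f c * g d * h e =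
    (\sum_c f c) * (\sum_c g c) * (\sum_c h c)
    - (\sum_c f c * g c) * (\sum_c h c) - (\sum_c f c * h c) * (\sum_c g c)
    - (\sum_c g c * h c) * (\sum_c f c) + (\sum_c f c * g c * h c) *+ 2.
Proof.
set F := \sum_c f c; set G := \sum_c g c; set H := \sum_c h c.
set GH := \sum_c g c * h c.
have inner c d : d != c -> \sum_(e | (e != c) && (e != d)) h e = H - h c - h d.
  move=> dc; rewrite /H [in RHS](bigD1 c) //= [in RHS](bigD1 d) //=; ring.
have outer c : \sum_(d | d != c) g d * (H - h c - h d) =
    G * (H - h c) - GH - g c * (H - h c - h c).
  rewrite /G /GH mulr_suml -sumrB [in RHS](bigD1 c) //=.
  by under eq_bigr do rewrite mulrBr; ring.
transitivity (\sum_c (f c * (G * H - GH) - f c * h c * G - f c * g c * H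
                      + f c * g c * h c *+ 2)).
  apply: eq_bigr => c _.
  transitivity (f c * \sum_(d | d != c) g d * (H - h c - h d)).
    rewrite mulr_sumr; apply: eq_bigr => d dc.
    by rewrite -inner // -mulr_sumr mulrA.
  by rewrite outer; ring.
rewrite big_split /= !sumrB -!mulr_suml sumrMnl.
by rewrite -/F -/G -/H; ring.
Qed.

(** Moving a vertex from one path to the other costs only terms that are linear
    in the [end_weight]s: this is what makes the sums below telescope. *)
Lemma end_weight_exchange p q c :
  end_weight p.+1 c * end_weight q c - end_weight p c * end_weight q.+1 c =
  path_weight q * end_weight p.+1 c - path_weight p * end_weight q.+1 c.
Proof. by rewrite !end_weightS; ring. Qed.

(** Joining the marked leaves of two paths by an edge gives one longer path, whose
    colourings are the pairs of colourings that differ at these leaves. *)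
Lemma sum_end_weight2 p q :
  \sum_c end_weight p c * end_weight q c =
  path_weight p * path_weight q - path_weight (p + q).
Proof.
elim: p q => [|p IHp] q.
  by rewrite big1 => [|c _]; rewrite ?mul0r // mul1r subrr.
have /eqP := IHp q.+1; rewrite -subr_eq0 addnS -addSn => /eqP IH.
apply/eqP; rewrite -subr_eq0 -[X in _ == X]IH -subr_eq0; apply/eqP.
set L := \sum_c _; set M := \sum_c _.
have LM : L - M = path_weight q * path_weight p.+1
                  - path_weight p * path_weight q.+1.
  rewrite /L /M -sumrB; under eq_bigr do rewrite end_weight_exchange.
  by rewrite sumrB -!mulr_sumr.
by rewrite -(subrK M L) LM; ring.
Qed.

(** Induction on [q]: vertices are moved from the second path to the first one
    until the second is empty, where the sum vanishes. *)
Lemma sum_end_weight3 p q r :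
  \sum_c end_weight p c * end_weight q c * end_weight r c =
  path_weight p * path_weight q * path_weight r
  - path_weight (p + q) * path_weight r
  + \sum_(i < q) path_weight i * path_weight (p + q + r - i)
  - \sum_(i < q) path_weight (p + i) * path_weight (q - i + r).
Proof.
elim: q p => [|q IHq] p.
  rewrite !big_ord0 big1 => [|c _]; last by rewrite mulr0 mul0r.
  by rewrite addn0 /(path_weight 0); ring.
have exch : \sum_c end_weight p c * end_weight q.+1 c * end_weight r c =
    \sum_c end_weight p.+1 c * end_weight q c * end_weight r c
    + path_weight p * (path_weight q.+1 * path_weight r
                       - path_weight (q.+1 + r))
    - path_weight q * (path_weight p.+1 * path_weight r
                       - path_weight (p.+1 + r)).
  rewrite -!sum_end_weight2 !mulr_sumr -big_split -sumrB /=.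
  by apply: eq_bigr => c _; rewrite !end_weightS; ring.
rewrite exch IHq big_ord_recr [in RHS]big_ord_recl /=.
rewrite addSnnS (_ : p + q.+1 + r - q = p.+1 + r)%N; last by lia.
rewrite addn0 subn0.
rewrite (_ : \sum_(i < q) path_weight (p + bump 0 i)
               * path_weight (q.+1 - bump 0 i + r) =
             \sum_(i < q) path_weight (p.+1 + i) * path_weight (q - i + r)).
  by ring.
by apply: eq_bigr => i _; rewrite /bump add1n addSnnS subSS.
Qed.

Lemma sun_weightE a b :
  \sum_c \sum_(d | d != c) \sum_(e | (e != c) && (e != d))
     end_weight a.+1 c * end_weight b.+1 d * end_weight b.+1 e =
  (\sum_(i < b.+1) path_weight i * path_weight (a + b.*2 + 3 - i)) *+ 2
  - (\sum_(i < b) path_weight (b.*2.+1 - i) * path_weight (a.+2 + i)) *+ 2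
  - path_weight b.*2.+2 * path_weight a.+1.
Proof.
rewrite sum_distinct !sum_end_weight !sum_end_weight2 sum_end_weight3.
rewrite (_ : a.+1 + b.+1 + b.+1 = a + b.*2 + 3)%N; last by lia.
rewrite [X in _ + (_ - X) *+ 2]big_ord_recl addn0 subn0.
rewrite (_ : b.+1 + b.+1 = b.*2.+2)%N; last by lia.
rewrite (_ : \sum_(i < b) path_weight (a.+1 + lift ord0 i)
                * path_weight (b.+1 - lift ord0 i + b.+1) =
             \sum_(i < b) path_weight (b.*2.+1 - i) * path_weight (a.+2 + i)).
  by ring.
apply: eq_bigr => i _; rewrite mulrC /lift /= /bump add1n.
have ib := ltn_ord i; congr (path_weight _ * path_weight _); lia.
Qed.

End PathWeights.

Arguments end_weight : simpl never.
Arguments path_weight : simpl never.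

(** * Sums over finite functions *)

Lemma forall_ord0 (P : pred 'I_0) : [forall i, P i] = true.
Proof. by apply/forallP => -[]. Qed.

Lemma forall_ordS m (P : pred 'I_m.+1) :
  [forall i, P i] = P ord0 && [forall i, P (lift ord0 i)].
Proof.
apply/forallP/andP => [allP | [P0 /forallP PS] i].
  by split=> //; apply/forallP.
by case: (unliftP ord0 i) => [j|] ->.
Qed.

Section FiniteFunctions.
Variables (R : comNzRingType) (C : finType).

Definition ffun_cons m (c : C) (g : {ffun 'I_m -> C}) : {ffun 'I_m.+1 -> C} :=
  [ffun i => oapp g c (unlift ord0 i)].

Lemma ffun_cons0 m c (g : {ffun 'I_m -> C}) : ffun_cons c g ord0 = c.
Proof. by rewrite ffunE unlift_none. Qed.

Lemma ffun_consS m c (g : {ffun 'I_m -> C}) i :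
  ffun_cons c g (lift ord0 i) = g i.
Proof. by rewrite ffunE liftK. Qed.

Lemma sum_ffun_ord0 (F : {ffun 'I_0 -> C} -> R) :
  \sum_f F f = F (ffun0 (card_ord 0)).
Proof.
rewrite (bigD1 (ffun0 (card_ord 0))) //= big1 ?addr0 // => f /eqP[].
by apply/ffunP => -[].
Qed.

Lemma sum_ffun_ordS m (F : {ffun 'I_m.+1 -> C} -> R) :
  \sum_f F f = \sum_c \sum_(g : {ffun 'I_m -> C}) F (ffun_cons c g).
Proof.
rewrite pair_big /= (reindex (fun cg => ffun_cons cg.1 cg.2)) //=.
exists (fun f => (f ord0, [ffun i => f (lift ord0 i)])) => [[c g]|f] _ /=.
  rewrite ffun_cons0; congr (_, _).
  by apply/ffunP => i; rewrite ffunE ffun_consS.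
apply/ffunP => i; case: (unliftP ord0 i) => [j|] ->; last by rewrite ffun_cons0.
by rewrite ffun_consS ffunE.
Qed.

Lemma prod_sum_dep (I : finType) (T : I -> finType) (F : forall i, T i -> R) :
  \prod_i \sum_(j : T i) F i j = \sum_(t : fprod T) \prod_i F i (t i).
Proof.
pose G i := [ffun j : T i => F i j].
transitivity (\sum_(t : fprod T) \prod_(i in I) G i (t i)); last first.
  by apply: eq_bigr => t _; apply: eq_bigr => i _; rewrite ffunE.
rewrite big_fprod.
rewrite -(bigA_distr_big_dep (tagged_with T) (fun i => untag 0 (G i))).
apply: eq_bigr => i _.
by rewrite -(big_tag (fun i => G i)); apply: eq_bigr => j _; rewrite ffunE.
Qed.

End FiniteFunctions.

(** * The chromatic symmetric function of a sun *)

Section SunColourings.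
Variables (R : comNzRingType) (n : nat) (x : 'I_n -> R).
Local Notation C := 'I_n.

(** Vertex 0 of the arm is the one joined to the triangle vertex, which has
    colour [c]. *)
Definition arm_proper m (c : C) (h : {ffun 'I_m -> C}) : bool :=
  [forall p : 'I_m, (p == 0%N :> nat) ==> (h p != c)] &&
  [forall p : 'I_m, forall q : 'I_m, (p.+1 == q :> nat) ==> (h p != h q)].

Lemma arm_proper_cons m c d (g : {ffun 'I_m -> C}) :
  arm_proper c (ffun_cons d g) = (d != c) && arm_proper d g.
Proof.
rewrite /arm_proper !forall_ordS ffun_cons0 eqxx implyTb.
have -> : [forall i : 'I_m, (lift ord0 i == 0%N :> nat) ==>
             (ffun_cons d g (lift ord0 i) != c)] by apply/forallP.
rewrite andbT; congr (_ && (_ && _)).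
  by apply: eq_forallb => i; rewrite ffun_consS lift0 eqSS eq_sym (eq_sym d).
apply: eq_forallb => i; rewrite forall_ordS lift0 /=; apply: eq_forallb => j.
by rewrite !ffun_consS eqSS.
Qed.

Lemma sum_arm_proper m c :
  \sum_(h : {ffun 'I_m -> C} | arm_proper c h) \prod_p x (h p) =
  arm_weight x m c.
Proof.
elim: m c => [|m IHm] c; rewrite big_mkcond /=.
  by rewrite sum_ffun_ord0 /arm_proper !forall_ord0 big_ord0.
rewrite sum_ffun_ordS [RHS]big_mkcond; apply: eq_bigr => d _ /=.
case: (eqVneq d c) => [->|dc].
  by rewrite big1 // => g _; rewrite arm_proper_cons eqxx.
rewrite -IHm mulr_sumr [RHS]big_mkcond; apply: eq_bigr => g _ /=.
rewrite arm_proper_cons dc /=; case: ifP => // _.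
rewrite big_ord_recl ffun_cons0; congr (_ * _).
by apply: eq_bigr => i _; rewrite ffun_consS.
Qed.

Variable l : 'I_3 -> nat.
Local Notation arms := (fprod (fun i => {ffun 'I_(l i) -> C})).

(** A colouring of the sun is a colouring [k] of the triangle together with a
    colouring of each arm; the arms have different lengths, whence the dependent
    product. *)
Definition glue (k : {ffun 'I_3 -> C}) (t : arms) : {ffun sun_vertex l -> C} :=
  [ffun v => match v with inl i => k i | inr q => t (tag q) (tagged q) end].

Definition sun_graph : sgraph := SGraph (@sun_edge_sym l) (@sun_edge_irr l).

Definition arm_vertex i (p : 'I_(l i)) : vertex sun_graph :=
  inr (Tagged (fun i => 'I_(l i)) p).

Lemma proper_glue k t :
  proper_colouring (G := sun_graph) (glue k t) =
  [forall i, forall j, (i != j) ==> (k i != k j)] &&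
  [forall i, arm_proper (k i) (t i)].
Proof.
apply/'forall_forallP/andP => [prop | [/'forall_forallP kP /forallP tP]].
  split.
    apply/'forall_forallP => i j.
    by have := prop (inl i) (inl j); rewrite !ffunE.
  apply/forallP => i; apply/andP; split.
    apply/forallP => p; have := prop (arm_vertex p) (inl i).
    by rewrite !ffunE /= eqxx.
  apply/'forall_forallP => p q; have := prop (arm_vertex p) (arm_vertex q).
  by rewrite !ffunE /= eqxx /=; case: (p.+1 == q).
have root i (p : 'I_(l i)) : p = 0%N :> nat -> t i p != k i.
  by move=> /eqP p0; have /andP[/forallP/(_ p)/implyP/(_ p0)] := tP i.
have step i (p q : 'I_(l i)) : p.+1 = q :> nat -> t i p != t i q.
  move=> /eqP pq.
  by have /andP[_ /'forall_forallP/(_ p q)/implyP/(_ pq)] := tP i.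
move=> [i|[i p]] [j|[j q]]; rewrite !ffunE //=; apply/implyP.
- by case/andP=> /eqP ji /eqP; subst j => /root; rewrite eq_sym.
- by case/andP=> /eqP ij /eqP; subst j => /root.
case/andP=> /eqP ij; subst j => /orP[] /eqP /step //.
by rewrite eq_sym.
Qed.

(** Once the triangle is coloured, the arms are coloured independently. *)
Lemma sum_proper_sun :
  \sum_(k | proper_colouring (G := sun_graph) k) \prod_v x (k v) =
  \sum_(k : {ffun 'I_3 -> C} | [forall i, forall j, (i != j) ==> (k i != k j)])
     \prod_i end_weight x (l i).+1 (k i).
Proof.
have glue_bij : {on predT, bijective (fun kt => glue kt.1 kt.2)}.
  exists (fun f => ([ffun i => f (inl i)],
      fprod_of_fun (fun i => [ffun p => f (arm_vertex p)]))).
    move=> [k t] _ /=; congr (_, _); first by apply/ffunP => i; rewrite !ffunE.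
    by apply/fprodP => i; rewrite fprodE; apply/ffunP => p; rewrite !ffunE.
  by move=> f _ /=; apply/ffunP => -[i|[i p]]; rewrite !ffunE // fprodE ffunE.
rewrite big_mkcond (reindex _ glue_bij) /= -(pair_bigA _ (fun k t =>
  if proper_colouring (G := sun_graph) (glue k t)
  then \prod_v x (glue k t v) else 0)) /= [RHS]big_mkcond.
apply: eq_bigr => k _; case: ifP => kP; last first.
  by apply: big1 => t _; rewrite proper_glue kP.
under [RHS]eq_bigr => i _ do rewrite end_weightS -arm_weightE -sum_arm_proper.
rewrite big_split /=; under [X in _ = _ * X]eq_bigr do rewrite big_mkcond.
rewrite prod_sum_dep mulr_sumr; apply: eq_bigr => t _.
rewrite proper_glue kP /=; case: ifP => [/forallP tP | /forallPn[i /negPf ti]].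
  rewrite big_sumType /=; congr (_ * _).
    by apply: eq_bigr => i _; rewrite ffunE.
  transitivity (\prod_i \prod_p x (t i p)).
    by rewrite sig_big_dep /=; apply: eq_bigr => -[i p] _; rewrite ffunE.
  by apply: eq_bigr => i _; rewrite tP.
by rewrite [X in _ * X](bigD1 i) //= ti mul0r mulr0.
Qed.

End SunColourings.

Lemma sum_proper_sun3 n (R : comNzRingType) (x : 'I_n -> R) a b :
  \sum_(k | proper_colouring (G := sun3 a b b) k) \prod_v x (k v) =
  (\sum_(i < b.+1) path_weight x i * path_weight x (a + b.*2 + 3 - i)) *+ 2
  - (\sum_(i < b) path_weight x (b.*2.+1 - i) * path_weight x (a.+2 + i)) *+ 2
  - path_weight x b.*2.+2 * path_weight x a.+1.
Proof.
rewrite -sun_weightE; have := sum_proper_sun x (tnth [tuple a; b; b]).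
rewrite -[sun_graph _]/(sun3 a b b) => ->.
rewrite big_mkcond sum_ffun_ordS; apply: eq_bigr => c _.
rewrite sum_ffun_ordS [RHS]big_mkcond; apply: eq_bigr => d _.
rewrite sum_ffun_ordS.
under eq_bigr => e _ do rewrite sum_ffun_ord0.
under eq_bigr => e _ do
  rewrite !big_ord_recl big_ord0 !forall_ordS !forall_ord0.
under eq_bigr do rewrite !ffun_consS !ffun_cons0 mulr1 mulrA.
case: (eqVneq d c) => [->|dc].
  by apply: big1.
rewrite [RHS]big_mkcond; apply: eq_bigr => e _; congr (if _ then _ else _).
by rewrite /= !andbT [c == e]eq_sym [d == e]eq_sym; case: eqP; case: eqP.
Qed.

(** * Paths and suns as polynomials in the elementary symmetric functions *)

Section PathSeq.
Variable R : nzRingType.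

(** [path_table e m] lists P_m, ..., P_0 in this order: the recursion refers to
    all earlier values. *)
Fixpoint path_table (e : nat -> R) (m : nat) : seq R :=
  if m is m'.+1 then
    (e m'.+1 + \sum_(j < m'.+1) j%:R * e j.+1 * (path_table e m')`_j)
      :: path_table e m'
  else [:: 1].

(** P_m as a polynomial in the elementary symmetric functions, evaluated at
    e_k = [e k]. *)
Definition path_seq e m := (path_table e m)`_0.

Lemma nth_path_table e m j :
  (j <= m)%N -> (path_table e m)`_j = path_seq e (m - j).
Proof.
by elim: m j => [|m IHm] [|j] //; rewrite ltnS => /IHm; rewrite subSS.
Qed.

Lemma path_seq0 e : path_seq e 0 = 1. Proof. by []. Qed.

Lemma path_seqS e m : path_seq e m.+1 =
  e m.+1 + \sum_(j < m.+1) j%:R * e j.+1 * path_seq e (m - j).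
Proof.
rewrite {1}/path_seq /=; congr (_ + _); apply: eq_bigr => j _.
by rewrite nth_path_table // -ltnS.
Qed.

Lemma path_seq_unique e u :
  u 0%N = 1 ->
  (forall m, u m.+1 = e m.+1 + \sum_(j < m.+1) j%:R * e j.+1 * u (m - j)%N) ->
  u =1 path_seq e.
Proof.
move=> u0 uS m; elim/ltn_ind: m => -[|m] IHm; first by rewrite u0.
rewrite uS path_seqS; congr (_ + _); apply: eq_bigr => j _.
by rewrite IHm // ltnS leq_subr.
Qed.

End PathSeq.

Arguments path_seq {R} e m : simpl never.

Lemma eq_path_seq (R : nzRingType) (e e' : nat -> R) :
  e =1 e' -> path_seq e =1 path_seq e'.
Proof.
move=> ee'; apply: path_seq_unique => // m; rewrite path_seqS ee'.
by under eq_bigr do rewrite ee'.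
Qed.

Lemma rmorph_path_seq (R S : nzRingType) (f : {rmorphism R -> S}) e m :
  f (path_seq e m) = path_seq (f \o e) m.
Proof.
apply: (path_seq_unique (u := f \o path_seq e)) => [|{}m] /=.
  by rewrite path_seq0 rmorph1.
rewrite path_seqS rmorphD rmorph_sum; congr (_ + _); apply: eq_bigr => j _.
by rewrite !rmorphM rmorph_nat.
Qed.

Section Elementary.
Variables (R : comNzRingType) (C : finType) (x : C -> R).

Lemma coef_epoly k :
  (epoly x)`_k = \sum_(h : {set C} | #|h| == k) \prod_(c in h) x c.
Proof.
rewrite /epoly; under eq_bigr do rewrite addrC.
rewrite bigA_distr coef_sum [RHS]big_mkcond; apply: eq_bigr => h _.
rewrite -big_mkcond /= scaler_prod prodr_const coefZ coefXn eq_sym.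
by case: eqP; rewrite ?mulr1 ?mulr0.
Qed.

Lemma path_weight_seq m : path_weight x m = path_seq (fun k => (epoly x)`_k) m.
Proof. by move: m; apply: path_seq_unique => // m; apply: path_weightS. Qed.

End Elementary.

(** The chromatic symmetric function of S(3;a,b,b), with [P m] for that of the
    path with [m] vertices. *)
Definition sun_expr (R : nzRingType) (P : nat -> R) (a b : nat) : R :=
  (\sum_(i < b.+1) P i * P (a + b.*2 + 3 - i)%N) *+ 2
  - (\sum_(i < b) P (b.*2.+1 - i)%N * P (a.+2 + i)%N) *+ 2
  - P b.*2.+2 * P a.+1.

Lemma rmorph_sun_expr (R S : nzRingType) (f : {rmorphism R -> S}) e a b :
  f (sun_expr (path_seq e) a b) = sun_expr (path_seq (f \o e)) a b.
Proof.
rewrite /sun_expr !rmorphB !rmorphMn !rmorph_sum !rmorphM !rmorph_path_seq.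
by congr (_ *+ 2 - _ *+ 2 - _); apply: eq_bigr => i _;
  rewrite rmorphM !rmorph_path_seq.
Qed.

Lemma eq_sun_expr (R : nzRingType) (P P' : nat -> R) a b :
  P =1 P' -> sun_expr P a b = sun_expr P' a b.
Proof.
move=> PP'; rewrite /sun_expr !PP'.
by congr (_ *+ 2 - _ *+ 2 - _); apply: eq_bigr => i _; rewrite !PP'.
Qed.

Lemma chromatic_symfun_sun3 a b n :
  chromatic_symfun (sun3 a b b) n = sun_expr (path_seq (mesym n int)) a b.
Proof.
rewrite /chromatic_symfun (sum_proper_sun3 (fun i => 'X_i)).
rewrite -/(sun_expr (path_weight (fun i : 'I_n => 'X_i : {mpoly int[n]})) a b).
apply: eq_sun_expr => m; rewrite path_weight_seq; apply: eq_path_seq => k.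
by rewrite coef_epoly.
Qed.

(** The variables are the negatives of the inverses of the complex roots of [q],
    which are nonzero as [q] has constant term 1. *)
Lemma elementary_specialisation (q : {poly int}) : q`_0 = 1 ->
  exists n (f : {rmorphism {mpoly int[n]} -> algC}),
    forall k, f (mesym n int k) = (q`_k)%:~R.
Proof.
move=> q0; pose qC : {poly algC} := map_poly intr q.
have [r qCr] := closed_field_poly_normal qC.
rewrite (big_nth 0) big_mkord in qCr.
have qC0 : lead_coef qC * \prod_(i < size r) (- r`_i) = 1.
  transitivity qC`_0; last by rewrite coef_map /= q0.
  rewrite [in RHS]qCr coefZ coef0_prod; congr (_ * _); apply: eq_bigr => i _.
  by rewrite coefB coefX coefC sub0r.
have r_neq0 (i : 'I_(size r)) : r`_i != 0.
  apply/eqP => ri0; have /eqP := qC0.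
  by rewrite (bigD1 i) //= ri0 oppr0 mul0r mulr0 eq_sym oner_eq0.
pose x (i : 'I_(size r)) := - (r`_i)^-1.
have xqC : epoly x = qC.
  have xr i : 1 + x i *: 'X = x i *: ('X - (r`_i)%:P).
    rewrite scalerBr -[X in _ - X]mul_polyC -polyCM mulNr mulVf // polyCN.
    by rewrite opprK addrC.
  rewrite /epoly (eq_bigr _ (fun i _ => xr i)) scaler_prod qCr; congr (_ *: _).
  have xr1 : (\prod_i x i) * \prod_(i < size r) (- r`_i) = 1.
    by rewrite -big_split big1 // => i _; rewrite /= mulrNN mulVf.
  by rewrite -[LHS]mul1r -{1}qC0 -mulrA [X in _ * X]mulrC xr1 mulr1.
exists (size r), (mmap intr x : {rmorphism _ -> algC}) => k.
rewrite -[RHS](coef_map intr) -/qC -xqC coef_epoly raddf_sum /=.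
apply: eq_bigr => h _; rewrite rmorph_prod; apply: eq_bigr => i _ /=.
by rewrite mmapX mmap1U.
Qed.

(** * Nonnegative specialisations *)

(** The specialisation sends each product of elementary symmetric functions to a
    product of values of [e], so an e-positive function to a nonnegative integer. *)
Lemma e_positive_specialisation a b (e : nat -> int) N :
  e 0%N = 1 -> (forall k, 0 <= e k) -> (forall k, (N <= k)%N -> e k = 0) ->
  e_positive (sun3 a b b) -> 0 <= sun_expr (path_seq e) a b.
Proof.
move=> e0 e_ge0 e_fin [c [[_ Xc] c_ge0]].
pose q := \poly_(k < N) e k.
have qE k : q`_k = e k.
  by rewrite coef_poly; case: ltnP => // /e_fin.
have [n [f fE]] := elementary_specialisation (etrans (qE 0%N) e0).
have fe k : f (mesym n int k) = intr (e k) by rewrite fE qE.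
have : 0 <= f (chromatic_symfun (sun3 a b b) n).
  rewrite Xc rmorph_sum sumr_ge0 // => l _.
  rewrite -mul_mpolyC rmorphM rmorph_prod mulr_ge0 //=.
    by rewrite -[c l]intz !rmorph_int ler0z.
  by apply: prodr_ge0 => k _; rewrite fe ler0z.
rewrite chromatic_symfun_sun3 rmorph_sun_expr.
rewrite (eq_sun_expr _ _ (eq_path_seq fe)).
by rewrite -(rmorph_sun_expr (intr : {rmorphism int -> algC})) ler0z.
Qed.

Lemma path_seq_ge0 (e : nat -> int) m :
  (forall k, 0 <= e k) -> 0 <= path_seq e m.
Proof.
move=> e_ge0; elim/ltn_ind: m => -[|m] IHm; first by rewrite path_seq0.
rewrite path_seqS addr_ge0 // sumr_ge0 // => j _.
by rewrite !mulr_ge0 // IHm // ltnS leq_subr.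
Qed.

(** * Suns with b at least 2 *)

Section LongParts.
Variable b : nat.

Definition long_spec (k : nat) : int :=
  ((k == 0%N) || (b.+2 <= k <= b.*2.+1)%N)%:R.
Local Notation P := (path_seq long_spec).

Let long_spec_ge0 k : 0 <= long_spec k. Proof. exact: ler0n. Qed.

Let path_ge0 m : 0 <= P m. Proof. exact: path_seq_ge0. Qed.

Lemma long_spec_out j : (0 < j <= b.+1)%N || (b.*2.+1 < j)%N -> long_spec j = 0.
Proof. by move=> jN; rewrite /long_spec (_ : _ || _ = false) //; lia. Qed.

Lemma long_spec_in j : (b.+2 <= j <= b.*2.+1)%N -> long_spec j = 1.
Proof. by rewrite /long_spec orbC => ->. Qed.

Lemma path_seq_short j : (0 < j <= b.+1)%N -> P j = 0.
Proof.
case: j => // j jb; rewrite path_seqS long_spec_out ?jb //.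
rewrite big1 ?addr0 // => i _.
case: (posnP i) => [->|i_gt0]; first by rewrite !mul0r.
by rewrite long_spec_out ?mulr0 ?mul0r //; have := ltn_ord i; lia.
Qed.

Lemma path_seq_long j : (b.+2 <= j <= b.*2.+1)%N -> P j = j%:R.
Proof.
case: j => // j jb; rewrite path_seqS long_spec_in // big_ord_recr /= big1.
  by rewrite long_spec_in // subnn path_seq0 add0r !mulr1 -natr1 addrC.
move=> i _; have ij := ltn_ord i; case: (leqP i b) => ib; last first.
  by rewrite path_seq_short ?mulr0 //; lia.
case: (posnP i) => [->|i_gt0]; first by rewrite !mul0r.
by rewrite long_spec_out ?mulr0 ?mul0r //; lia.
Qed.

(** The recursion, with the index of summation reversed so as to match the sum
    in [sun_expr]: the part of size 2b+1-i leaves m+i. *)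
Lemma path_seq_rec m : P (m + b.*2.+1) =
  long_spec (m + b.*2.+1) + \sum_(i < b) (b.*2 - i)%:R * P (m + i).
Proof.
rewrite addnS path_seqS; congr (_ + _); rewrite -addnS.
pose F j := j%:R * long_spec j.+1 * path_seq long_spec (m + b.*2 - j).
rewrite -(big_mkord predT F) (@big_cat_nat _ _ _ b.+1) //=; last by lia.
rewrite (@big_cat_nat _ _ _ b.*2.+1 b.+1) //=; try lia.
rewrite big_nat_cond big1 => [|j jb]; last first.
  rewrite /F; case: (posnP j) => [->|j_gt0]; first by rewrite !mul0r.
  by rewrite long_spec_out ?mulr0 ?mul0r //; lia.
rewrite [X in _ + (_ + X)]big_nat_cond.
rewrite [X in _ + (_ + X)]big1 => [|j jb]; last first.
  by rewrite /F long_spec_out ?mulr0 ?mul0r //; lia.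
rewrite add0r addr0 big_nat_rev -{1}[b.+1]add0n big_addn /=.
rewrite (_ : b.*2.+1 - b.+1 = b)%N ?big_mkord; last by lia.
apply: eq_bigr => i _; have ib := ltn_ord i.
rewrite /F (_ : b.+1 + b.*2.+1 - (i + b.+1).+1 = b.*2 - i)%N; last by lia.
rewrite long_spec_in ?mulr1; last by lia.
by congr (_ * path_seq _ _); lia.
Qed.

(** The term 2 P_n contributes each P_(n-j) with the factor 2(j-1), and the
    products P_j P_(n-j) contribute it with the factor -2j. *)
Lemma sun_expr_long a : sun_expr P a b =
  - (\sum_(i < b) P (a.+2 + i)) *+ 2 - P b.*2.+2 * P a.+1.
Proof.
rewrite /sun_expr; congr (_ - _).
rewrite big_ord_recl /= big1 => [|i _]; last first.
  by rewrite path_seq_short ?mul0r // /bump /=; have := ltn_ord i; lia.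
rewrite addr0 subn0 path_seq0 mul1r -mulrnBl; congr (_ *+ 2).
rewrite (_ : a + b.*2 + 3 = a.+2 + b.*2.+1)%N; last by lia.
rewrite path_seq_rec long_spec_out; last by lia.
rewrite add0r -sumrB -sumrN; apply: eq_bigr => i _; have ib := ltn_ord i.
rewrite (@path_seq_long (b.*2.+1 - i)); last by lia.
by rewrite subSn ?(ltnW (leq_trans ib _)) -?addnn ?leq_addr // -natr1; ring.
Qed.

(** With n = m + 2b + 1, some P_(n-j) with j in the interval [b+2, 2b+1] is
    positive.  If n <= 4b+2, both j and n-j can be taken in this interval;
    otherwise j = b+2 leaves a smaller n to which induction applies.  For b = 2
    the value n = 11 fails, so that n = 15 = 5 + 10 is reached by j = 5 instead
    of j = 4. *)
Lemma path_seq_gt0 m : (2 <= b)%N -> (3 <= m)%N -> (b != 2%N) || (m != 6%N) ->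
  exists2 i : 'I_b, 0 < P (m + i) & 0 < P (m + b.*2.+1).
Proof.
move=> b_ge2; elim/ltn_ind: m => m IHm m_ge3 bm.
suff [i im] : exists i : 'I_b, 0 < P (m + i).
  exists i => //; rewrite path_seq_rec (bigD1 i) //= ltr_wpDl // ltr_pwDl //.
    by rewrite mulr_gt0 // ltr0n; have := ltn_ord i; lia.
  by rewrite sumr_ge0 // => j _; rewrite mulr_ge0.
have b_gt0 : (0 < b)%N by lia.
have b1_lt : (b.-1 < b)%N by lia.
have gt0_long k : (b.+2 <= k <= b.*2.+1)%N -> 0 < P k.
  by move=> kb; rewrite path_seq_long // ltr0n; lia.
(* As n - j = m + i, the index i = b - 1 stands for j = b + 2 and i = 0 for
   j = 2b + 1. *)
case: (leqP m b.+2) => [m_le | m_gt].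
  by exists (Ordinal b1_lt); apply: gt0_long; rewrite /=; lia.
case: (leqP m b.*2.+1) => [m_le2 | m_gt2].
  by exists (Ordinal b_gt0); apply: gt0_long; rewrite /=; lia.
case: (boolP ((b == 2) && (m == 10)))%N => [/andP[/eqP b2 /eqP m10] | bm'].
  exists (Ordinal b_gt0); rewrite addn0 (_ : m = 5 + b.*2.+1)%N; last by lia.
  by have [|||i _ ->] := IHm 5%N; rewrite ?b2 //; lia.
exists (Ordinal b1_lt) => /=.
rewrite (_ : m + b.-1 = (m - b.+2) + b.*2.+1)%N; last by lia.
by have [|||i _ ->//] := IHm (m - b.+2)%N; lia.
Qed.

Lemma sun_expr_long_lt0 a : (2 <= b)%N -> (0 < a)%N ->
  (b != 2%N) || (a != 4%N) -> sun_expr P a b < 0.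
Proof.
move=> b_ge2 a_gt0 ab.
have [||i im _] := path_seq_gt0 (m := a.+2) b_ge2; try lia.
rewrite sun_expr_long mulNrn -opprD oppr_lt0 ltr_pwDl ?mulr_ge0 //.
rewrite pmulrn_lgt0 // (bigD1 i) //= ltr_pwDl // sumr_ge0 //.
Qed.

End LongParts.

(** * Suns with b equal to 1 *)

Lemma sun_expr_b1 (P : nat -> int) a : P 0%N = 1 -> P 1%N = 0 ->
  sun_expr P a 1 = P a.+4.+1 *+ 2 - (P 3%N * P a.+2) *+ 2 - P 4%N * P a.+1.
Proof.
move=> P0 P1; rewrite /sun_expr (_ : a + 1.*2 + 3 = a.+4.+1)%N; last by lia.
rewrite !big_ord_recl !big_ord0 /= P0 P1.
by rewrite !subn0 !addn0 mul0r mul1r !addr0.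
Qed.

Definition spec23 (k : nat) : int := (k \in [:: 0; 2; 3]%N)%:R.

Lemma path_seq_spec23 (P := path_seq spec23) :
  [/\ P 1%N = 0, P 2%N = 2, P 3%N = 3 &
      forall m, P m.+4 = P m.+2 + 2 * P m.+1].
Proof.
have P0 : P 0%N = 1 by [].
have P1 : P 1%N = 0 by rewrite /P path_seqS !big_ord_recl big_ord0.
have P2 : P 2%N = 2.
  by rewrite /P path_seqS !big_ord_recl big_ord0 -/P /= !(P0, P1).
have P3 : P 3%N = 3.
  by rewrite /P path_seqS !big_ord_recl big_ord0 -/P /= !(P0, P1, P2).
split=> // m; rewrite /P path_seqS add0r !big_ord_recl big1 => [|i _].
  rewrite /= /bump /= !addn0 !subSS subn0 -/P /spec23 /=.
  by rewrite !(mul0r, mul1r, mulr0, mulr1, add0r, addr0).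
by rewrite /spec23 /= mulr0 mul0r.
Qed.

(** The value is 2 D(a), where D satisfies the same linear recursion as the path
    sequence, with nonnegative coefficients; three consecutive negative values,
    here at 9, 10, 11, make all later ones negative. *)
Lemma sun_expr_spec23_lt0 a : (0 < a)%N -> a \notin [:: 2; 5; 8]%N ->
  sun_expr (path_seq spec23) a 1 < 0.
Proof.
have [P1 P2 P3 Prec] := path_seq_spec23.
set P := path_seq spec23 in P1 P2 P3 Prec *.
rewrite sun_expr_b1 // P3 (Prec 0) P1 P2.
pose D k := P k.+4.+1 - 3 * P k.+2 - P k.+1.
suff D_lt0 : (0 < a)%N -> a \notin [:: 2; 5; 8]%N -> D a < 0.
  by move=> a0 aN; have := D_lt0 a0 aN; rewrite /D; lia.
have Drec k : D k.+3 = D k.+1 + 2 * D k.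
  by rewrite /D; have := Prec k.+4; have := Prec k.+1; have := Prec k; lia.
have D0 : D 0%N = 1 by rewrite /D !Prec P3 P2 P1.
have D1 : D 1%N = - 3 by rewrite /D !Prec P3 P2 P1.
have D2 : D 2%N = 2 by rewrite /D !Prec P3 P2 P1.
have D_lt0 k : (9 <= k)%N -> D k < 0.
  elim/ltn_ind: k => k IHk k_ge9; case: (leqP 12 k) => [k_ge12 | k_lt12].
    have D9 := IHk k.-2.-1 ltac:(lia) ltac:(lia).
    have D10 := IHk k.-2 ltac:(lia) ltac:(lia).
    have := Drec k.-2.-1; rewrite (_ : k.-2.-1.+3 = k); last by lia.
    rewrite (_ : k.-2.-1.+1 = k.-2); last by lia.
    lia.
  have : [|| k == 9, k == 10 | k == 11]%N by lia.
  by case/or3P=> /eqP ->; rewrite !Drec D0 D1 ?D2.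
case: (leqP 9 a) => [/D_lt0 // | a_lt9].
by move: a a_lt9 => [|[|[|[|[|[|[|[|[|a]]]]]]]]] //= _ _ _;
  rewrite ?Drec ?D0 ?D1 ?D2.
Qed.

Definition spec34 (k : nat) : int := (k \in [:: 0; 3; 4]%N)%:R.

Lemma path_seq_spec34 (P := path_seq spec34) :
  [/\ P 1%N = 0, P 2%N = 0, P 3%N = 3, P 4%N = 4 &
      forall m, P m.+4.+1 = 2 * P m.+2 + 3 * P m.+1].
Proof.
have P0 : P 0%N = 1 by [].
have P1 : P 1%N = 0 by rewrite /P path_seqS !big_ord_recl big_ord0.
have P2 : P 2%N = 0.
  by rewrite /P path_seqS !big_ord_recl big_ord0 -/P /= !(P0, P1).
have P3 : P 3%N = 3.
  by rewrite /P path_seqS !big_ord_recl big_ord0 -/P /= !(P0, P1, P2).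
have P4 : P 4%N = 4.
  by rewrite /P path_seqS !big_ord_recl big_ord0 -/P /= !(P0, P1, P2, P3).
split=> // m; rewrite /P path_seqS add0r !big_ord_recl big1 => [|i _].
  rewrite /= /bump /= !addn0 !subSS subn0 -/P /spec34 /=.
  by rewrite !(mul0r, mul1r, mulr0, mulr1, add0r, addr0).
by rewrite /spec34 /= mulr0 mul0r.
Qed.

Lemma sun_expr_spec34_lt0 a : a \in [:: 2; 5; 8]%N ->
  sun_expr (path_seq spec34) a 1 < 0.
Proof.
have [P1 P2 P3 P4 Prec] := path_seq_spec34.
rewrite sun_expr_b1 // P3 P4 !inE => /or3P[] /eqP->.
all: rewrite !(Prec, P4, P3, P2, P1); lia.
Qed.

(** * The sun S(3;4,2,2) *)

(** Polynomials in the e_k with natural coefficients, in a form that computes: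
    the pair [(l, z)] stands for z times the product of the e_k, k in l. *)
Definition eterms := seq (seq nat * nat).

Fixpoint insert_term (l : seq nat) (z : nat) (p : eterms) : eterms :=
  if p is t :: p' then
    if t.1 == l then (l, t.2 + z)%N :: p' else t :: insert_term l z p'
  else [:: (l, z)].

Definition add_terms (p q : eterms) : eterms :=
  foldr (fun t => insert_term t.1 t.2) q p.

Definition mul_terms (p q : eterms) : eterms :=
  foldr (fun t => add_terms^~ [seq (merge geq t.1 s.1, t.2 * s.2)%N | s <- q])
    [::] p.

Arguments mul_terms : simpl never.
Arguments add_terms : simpl never.

(** The computable counterpart of [path_table]; the term j = 0 of the recursion,
    which vanishes, is left out. *)
Fixpoint path_terms_table (m : nat) : seq eterms :=
  if m is m'.+1 then
    let T := path_terms_table m' in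
    foldr (fun j => add_terms^~ (mul_terms [:: ([:: j.+1], j)] (nth [::] T j)))
      [:: ([:: m'.+1], 1%N)] (iota 1 m') :: T
  else [:: [:: ([::], 1%N)]].

Section Evaluation.
Variables (R : comNzRingType) (e : nat -> R).

Definition eval_terms (p : eterms) : R :=
  \sum_(t <- p) (\prod_(k <- t.1) e k) *+ t.2.

Lemma eval_insert_term l z p :
  eval_terms (insert_term l z p) = eval_terms p + (\prod_(k <- l) e k) *+ z.
Proof.
elim: p => [|[l' z'] p IHp] /=.
  by rewrite /eval_terms big_seq1 big_nil add0r.
case: eqP => [->|_]; rewrite /eval_terms !big_cons /=.
  by rewrite mulrnDr addrAC.
by rewrite -/(eval_terms _) IHp addrA.
Qed.

Lemma eval_add_terms p q :
  eval_terms (add_terms p q) = eval_terms p + eval_terms q.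
Proof.
elim: p => [|t p IHp]; first by rewrite [eval_terms [::]]big_nil add0r.
rewrite /add_terms /= -/(add_terms p q).
by rewrite eval_insert_term IHp [eval_terms (t :: p)]big_cons addrC addrA.
Qed.

Lemma eval_mul_terms p q :
  eval_terms (mul_terms p q) = eval_terms p * eval_terms q.
Proof.
elim: p => [|t p IHp]; first by rewrite [eval_terms [::]]big_nil mul0r.
rewrite /mul_terms /= -/(mul_terms p q).
rewrite eval_add_terms IHp [eval_terms (t :: p)]big_cons mulrDl addrC.
congr (_ + _); rewrite {1}/eval_terms big_map mulr_sumr.
apply: eq_bigr => s _ /=.
rewrite (perm_big (t.1 ++ s.1)) ?big_cat /=; last by rewrite perm_merge.
by rewrite mulrnAl mulrnAr -mulrnA [(t.2 * _)%N]mulnC.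
Qed.

Lemma eval_path_terms_table m j : (j <= m)%N ->
  eval_terms (nth [::] (path_terms_table m) j) = path_seq e (m - j).
Proof.
elim: m j => [|m IHm] [|j] // jm.
- by rewrite /= /eval_terms big_seq1 big_nil.
- rewrite subn0 path_seqS /=.
  pose F j := j%:R * e j.+1 * path_seq e (m - j).
  rewrite -(big_mkord predT F) big_ltn // {1}/F !mul0r add0r.
  rewrite /index_iota subn1 /=.
  have: all (fun j => j <= m)%N (iota 1 m).
    by apply/allP => j; rewrite mem_iota; lia.
  elim: (iota 1 m) => [|j s IHs] /=.
    by rewrite /eval_terms !big_seq1 !big_nil addr0.
  case/andP=> jm' /IHs {}IHs.
  rewrite eval_add_terms IHs eval_mul_terms big_cons.
  rewrite IHm // [eval_terms [:: _]]big_seq1 /= big_seq1 /F mulr_natl.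
  by rewrite -addrA [X in _ + X]addrC.
by rewrite IHm // subSS.
Qed.

End Evaluation.

Definition path_terms (m : nat) : eterms := head [::] (path_terms_table m).

Lemma eval_path_terms (R : comNzRingType) (e : nat -> R) m :
  eval_terms e (path_terms m) = path_seq e m.
Proof. by rewrite -[in RHS](subn0 m) -eval_path_terms_table // nth0. Qed.

Lemma e_positive_terms G (p : eterms) :
  all is_partition (unzip1 p) ->
  (forall n, chromatic_symfun G n = eval_terms (mesym n int) p) ->
  e_positive G.
Proof.
move=> /allP p_part XG.
pose coef l := (\sum_(t <- p | t.1 == l) t.2)%N.
pose c : {fsfun seq nat -> int with 0} :=
  [fsfun l in [fset l in unzip1 p]%fset => (coef l)%:Z].
have cE l : c l = (coef l)%:Z.
  rewrite fsfunE; case: ifPn => //; rewrite inE /= => lp.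
  rewrite /coef big_seq_cond big1 // => t /andP[tp /eqP tl].
  by rewrite -tl map_f in lp.
have c_supp l : l \in finsupp c -> l \in unzip1 p.
  by move/(fsubsetP (finsupp_sub _ _ _)); rewrite inE.
exists c; split; last by move=> l; rewrite cE.
split=> [l /c_supp /p_part // | n]; rewrite XG.
pose A := [fset l in unzip1 p]%fset.
transitivity (\sum_(l <- A) c l *: elem_symfun l n); last first.
  apply/esym/big_fset_incl; first exact: finsupp_sub.
  by move=> l _ /fsfun_dflt ->; rewrite scale0r.
transitivity (\sum_(l <- A) \sum_(t <- p | t.1 == l) elem_symfun t.1 n *+ t.2).
  rewrite (exchange_big_dep xpredT) //= /eval_terms big_seq [RHS]big_seq.
  apply: eq_bigr => t tp; rewrite [RHS]big_mkcond.
  rewrite [RHS](bigD1_seq t.1) ?fset_uniq ?inE ?map_f //=.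
  by rewrite eqxx [X in _ + X]big1 ?addr0 // => l; rewrite eq_sym => /negPf ->.
apply: eq_bigr => l _; rewrite cE /coef.
rewrite -natz scaler_nat -sumrMnr.
by apply: eq_bigr => t /eqP ->.
Qed.

(** The positive and the negative part of [sun_expr] for a = 4, b = 2.  The path
    terms are a parameter, so that evaluation lemmas never unfold them. *)
Definition sun42_plus (P : nat -> eterms) : eterms :=
  mul_terms [:: ([::], 2%N)]
    (add_terms (add_terms (P 11%N) (mul_terms (P 1%N) (P 10%N)))
               (mul_terms (P 2%N) (P 9%N))).

Definition sun42_minus (P : nat -> eterms) : eterms :=
  add_terms (mul_terms [:: ([::], 2%N)] (mul_terms (P 4%N) (P 7%N)))
            (mul_terms [:: ([::], 3%N)] (mul_terms (P 5%N) (P 6%N))).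

(** The subtraction is truncated; [sun42_balance] shows that it never has to be,
    which is the e-positivity of S(3;4,2,2). *)
Definition sun42_terms : eterms :=
  let minus := sun42_minus path_terms in
  [seq (t.1, t.2 - sumn [seq s.2 | s <- minus & s.1 == t.1])%N
     | t <- sun42_plus path_terms].

Lemma sun42_balance :
  add_terms (sun42_minus path_terms) sun42_terms = sun42_plus path_terms.
Proof. by vm_compute. Qed.

Lemma eval_sun42_plus_minus (R : comNzRingType) (e : nat -> R) P u :
  (forall m, eval_terms e (P m) = u m) -> u 0%N = 1 ->
  sun_expr u 4 2 = eval_terms e (sun42_plus P) - eval_terms e (sun42_minus P).
Proof.
move=> Pu u0; have const z : eval_terms e [:: ([::], z)] = z%:R.
  by rewrite /eval_terms big_seq1 big_nil.
have -> : eval_terms e (sun42_plus P) =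
    2 * (u 11%N + u 1%N * u 10%N + u 2%N * u 9%N).
  by rewrite eval_mul_terms !eval_add_terms !eval_mul_terms const !Pu.
have -> : eval_terms e (sun42_minus P) =
    2 * (u 4%N * u 7%N) + 3 * (u 5%N * u 6%N).
  by rewrite eval_add_terms !eval_mul_terms !const !Pu.
rewrite /sun_expr !big_ord_recl !big_ord0 u0.
rewrite -[LHS]/((1 * u 11%N + (u 1%N * u 10%N + (u 2%N * u 9%N + 0))) *+ 2
                - (u 5%N * u 6%N + (u 4%N * u 7%N + 0)) *+ 2 - u 6%N * u 5%N).
by ring.
Qed.

Lemma sun_expr42 (R : comNzRingType) (e : nat -> R) :
  sun_expr (path_seq e) 4 2 = eval_terms e sun42_terms.
Proof.
rewrite (eval_sun42_plus_minus (eval_path_terms e)) //.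
by rewrite -sun42_balance eval_add_terms addrAC subrr add0r.
Qed.

Lemma e_positive_sun42 : e_positive (sun3 4 2 2).
Proof.
apply: (@e_positive_terms _ sun42_terms); first by vm_compute.
by move=> n; rewrite chromatic_symfun_sun3 sun_expr42.
Qed.

(** * Conclusion *)

Lemma sun3_e_positive_params a b : (0 < a)%N -> (0 < b)%N ->
  e_positive (sun3 a b b) -> a = 4%N /\ b = 2%N.
Proof.
move=> a_gt0 b_gt0 Gpos.
have not_lt0 (e : nat -> int) N : e 0%N = 1 -> (forall k, 0 <= e k) ->
    (forall k, (N <= k)%N -> e k = 0) -> sun_expr (path_seq e) a b < 0 -> False.
  move=> e0 e_ge0 e_fin; apply/negP; rewrite -leNgt.
  exact: e_positive_specialisation e_fin Gpos.
case: (leqP 2 b) => [b_ge2 | b_lt2].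
  case: (boolP ((a == 4) && (b == 2)))%N => [/andP[/eqP-> /eqP->] // | ab].
  exfalso; apply: (not_lt0 (long_spec b) b.*2.+2) => // [k k_gt|].
    by rewrite long_spec_out // k_gt orbT.
  by apply: sun_expr_long_lt0; lia.
have b1 : b = 1%N by lia.
rewrite {}b1 in not_lt0; exfalso.
case: (boolP (a \in [:: 2; 5; 8]%N)) => aN.
  apply: (not_lt0 spec34 5%N) => // [k k_ge|].
    by rewrite /spec34 !inE !gtn_eqF //; lia.
  exact: sun_expr_spec34_lt0.
apply: (not_lt0 spec23 4%N) => // [k k_ge|].
  by rewrite /spec23 !inE !gtn_eqF //; lia.
exact: sun_expr_spec23_lt0.
Qed.

Local Close Scope ring_scope.

Theorem theorem3p19 (a b : nat) (ha : 1 <= a) (hb : 1 <= b) :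
  e_positive (sun3 a b b) <-> (a = 4 /\ b = 2).
Proof.
split; last by case=> -> ->; apply: e_positive_sun42.
exact: sun3_e_positive_params.
Qed.
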